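(* Let $(M,h)$ be a closed Riemannian spin surface with local isothermal coordinates $x,y$ on an open subset, let $\lambda,\kappa\in\mathbb{R}$, and let $\psi=(\psi^1,\dots,\psi^q)\in\Gamma(\Sigma M\otimes\mathbb{R}^q)$ be a smooth solution of $$\not\partial\psi^i=\lambda\psi^i+\kappa|\psi|^2\psi^i,\qquad i=1,\dots,q.$$ Suppose moreover that for all $i,m\in\{1,\dots,q\}$, with summation over $j=1,\dots,q$, $$|P_-\psi^j|_{\Sigma M}^2\langle P_-\psi^i,P_-\psi^m\rangle_{\Sigma M}=|P_+\psi^j|_{\Sigma M}^2\langle P_+\psi^i,P_+\psi^m\rangle_{\Sigma M}.$$ Then the Noether current $J^{im}_\alpha:=\langle\psi^i,\partial_\alpha\cdot\psi^m\rangle_{\Sigma M}$, $\alpha\in\{x,y\}$, satisfies $$\partial_xJ_y^{im}-\partial_yJ_x^{im}-\kappa(J^{ij}_xJ^{jm}_y-J^{ij}_yJ^{jm}_x)=2\lambda\langle\psi^i,\partial_x\cdot\partial_y\cdot\psi^m\rangle_{\Sigma M}$$ for all $i,m$, with summation over $j$.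
   Context: $\Sigma M$ is the (complex rank 2) spinor bundle of $(M,h)$ with hermitian scalar product $\langle\cdot,\cdot\rangle_{\Sigma M}$ and metric spin connection $\nabla^{\Sigma M}$. Clifford multiplication by tangent vectors is skew-symmetric, $\langle\psi,X\cdot\eta\rangle=-\langle X\cdot\psi,\eta\rangle$, and satisfies $X\cdot Y\cdot\psi+Y\cdot X\cdot\psi=-2h(X,Y)\psi$. For an oriented local orthonormal frame $e_1,e_2$: $\not\partial=\sum_\alpha e_\alpha\cdot\nabla^{\Sigma M}_{e_\alpha}$ is the Dirac operator, $\omega_{\mathbb{C}}=i\,e_1\cdot e_2$ is the complex volume element, and $P_\pm=\frac12(1\pm\omega_{\mathbb{C}})$ are the projectors onto positive and negative spinors. $|\psi|^2=\sum_{j=1}^q|\psi^j|^2_{\Sigma M}$. *)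

(* Defs.v *)
From HB Require Import structures.
From mathcomp Require Import all_boot all_order all_algebra.
From mathcomp Require Import complex ring lra.
From mathcomp Require Import all_classical all_reals all_analysis.

Set Implicit Arguments.
Unset Strict Implicit.
Unset Printing Implicit Defensive.
Import Order.TTheory GRing.Theory Num.Theory.
Import numFieldNormedType.Exports.

#[global] Open Scope classical_set_scope.
#[global] Open Scope ring_scope.
#[global] Open Scope complex_scope.

(* A closed Riemannian spin surface, its spinor bundle and its Dirac operator,
   written in charts and local trivializations (mathcomp-analysis has no
   manifolds).
   Conventions:
   - points and tangent vectors of the coordinate plane are row vectors, so
     that, as for the library's Jacobian, the differential of f at p is
     v |-> v *m 'J f p;
   - values of spinor fields in a local trivialization are column vectors of
     C^2;
   - the hermitian product is linear in its first argument. Exchanging the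
     linear and the antilinear slot only conjugates both the hypotheses and the
     conclusion of the theorem, since lambda and kappa are real. *)

Section Calculus.
Variable R : realType.

Definition plane := 'rV[R]_2.

Definition e_ (k : 'I_2) : plane := delta_mx 0 k.

Definition pder (k : 'I_2) (f : plane -> R^o) : plane -> R^o :=
  fun p => 'D_(e_ k) f p.

(* C^oo on the open set U: every iterated partial derivative (including f
   itself) is differentiable at every point of U *)
Definition smooth_on (U : set plane) (f : plane -> R^o) : Prop :=
  forall (s : seq 'I_2) (p : plane), U p -> differentiable (foldr pder f s) p.

Definition csmooth_on (U : set plane) (f : plane -> R[i]) : Prop :=
  smooth_on U (fun p => complex.Re (f p)) /\
  smooth_on U (fun p => complex.Im (f p)).

Definition cpder (k : 'I_2) (f : plane -> R[i]) (p : plane) : R[i] :=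
  pder k (fun q => complex.Re (f q)) p +i* pder k (fun q => complex.Im (f q)) p.

End Calculus.

Arguments e_ {R} k.

Section Surface.
Variables (R : realType) (M : topologicalType).

(* Only the values of chart_map on dom and of param on the image
   chart_map @` dom are meaningful. *)
Record chart := Chart {
  dom : set M;
  chart_map : M -> plane R;
  param : plane R -> M;
  dom_open : open dom;
  img_open : open (chart_map @` dom);
  param_coord : forall x, dom x -> param (chart_map x) = x;
  chart_map_cont : forall x, dom x -> {for x, continuous chart_map};
  param_cont : forall p, (chart_map @` dom) p -> {for p, continuous param} }.

Definition trans (c d : chart) : plane R -> plane R := chart_map d \o param c.

Definition smooth_trans (c d : chart) : Prop :=
  forall k : 'I_2,
    smooth_on (chart_map c @` (dom c `&` dom d)) (fun p => trans c d p 0 k).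

Record smooth_structure := SmoothStructure {
  atlas : set chart;
  atlas_cover : forall x : M, exists2 c, atlas c & dom c x;
  atlas_smooth : forall c d, atlas c -> atlas d -> smooth_trans c d;
  atlas_maximal : forall c,
    (forall d, atlas d -> smooth_trans c d /\ smooth_trans d c) -> atlas c }.

(* gram c p is the matrix h(d_k, d_l) of the metric in the coordinates c. *)
Record riemannian_metric (S : smooth_structure) := RiemannianMetric {
  gram : chart -> plane R -> 'M[R]_2;
  gram_smooth : forall c, atlas S c ->
    forall k l, smooth_on (chart_map c @` dom c) (fun p => gram c p k l);
  gram_sym : forall c, atlas S c ->
    forall p, (chart_map c @` dom c) p -> (gram c p)^T = gram c p;
  gram_pos : forall c, atlas S c -> forall p, (chart_map c @` dom c) p ->
    forall v : 'rV[R]_2, v != 0 -> 0 < (v *m gram c p *m v^T) 0 0;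
  gram_trans : forall c d, atlas S c -> atlas S d ->
    forall p, (chart_map c @` (dom c `&` dom d)) p ->
    gram c p =
      'J (trans c d) p *m gram d (trans c d p) *m ('J (trans c d) p)^T }.

Definition isothermal (S : smooth_structure) (h : riemannian_metric S)
    (c : chart) : Prop :=
  forall p, (chart_map c @` dom c) p ->
    exists2 r : R, 0 < r & gram h c p = r%:M.

(* Gamma^s_{mn} of the Levi-Civita connection; covder is nabla_v V. *)
Definition christoffel (S : smooth_structure) (h : riemannian_metric S)
    (c : chart) (p : plane R) (s m n : 'I_2) : R :=
  2^-1 * \sum_(t < 2) (invmx (gram h c p)) s t *
    (pder m (fun q => gram h c q n t) p + pder n (fun q => gram h c q m t) p
     - pder t (fun q => gram h c q m n) p).

Definition covder (S : smooth_structure) (h : riemannian_metric S)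
    (c : chart) (v : 'rV[R]_2) (V : plane R -> 'rV[R]_2) (p : plane R)
    : 'rV[R]_2 :=
  \row_(s < 2) \sum_(m < 2) v 0 m *
    (pder m (fun q => V q 0 s) p
     + \sum_(n < 2) christoffel h c p s m n * V p 0 n).

End Surface.

Section Spin.
Variable R : realType.

(* The complex spinor representation: gam 0 and gam 1 are the Clifford actions
   of the two vectors of an oriented orthonormal frame. *)
Definition gam (k : 'I_2) : 'M[R[i]]_2 :=
  \matrix_(r, s) (if r == s then 0
                  else if k == 0 then 'i
                  else if r == 0 then 1 else - 1).

Definition rotation (z : R[i]) : 'M[R]_2 :=
  \matrix_(k, l) (if k == l then complex.Re z
                  else if k == 0 then complex.Im z else - complex.Im z).

(* The unit complex number s stands for the element Re s + Im s e_1 e_2 of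
   Spin(2). It acts on spinors by spin_act s and covers the rotation of angle
   arg (s^2), see [spin_act_gam]. *)
Definition spin_act (s : R[i]) : 'M[R[i]]_2 :=
  (complex.Re s)%:C%:M + (complex.Im s)%:C *: (gam 0 *m gam 1).

Definition hdot (v w : 'cV[R[i]]_2) : R[i] := \sum_(k < 2) v k 0 * (w k 0)^*.

End Spin.

Arguments gam {R} k.

Section Checks.
Variable R : realType.

Lemma gam_clifford (k l : 'I_2) :
  (gam k : 'M[R[i]]_2) *m gam l + gam l *m gam k = (- (k == l)%:R *+ 2)%:M.
Proof.
apply/matrixP => r s; rewrite !mxE !big_ord_recl !big_ord0 !mxE.
by case: k l r s => [[|[|//]] ?] [[|[|//]] ?] [[|[|//]] ?] [[|[|//]] ?];
  rewrite /= ?mulr0 ?mulr0n; apply/eqP; rewrite eq_complex /= ?mulr1n;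
  apply/andP; split; apply/eqP; lra.
Qed.

Lemma gam_skew (k : 'I_2) (v w : 'cV[R[i]]_2) :
  hdot v (gam k *m w) = - hdot (gam k *m v) w.
Proof.
rewrite /hdot !big_ord_recl !big_ord0 !mxE !big_ord_recl !big_ord0 !mxE.
set v0 := v 0 0; set w0 := w 0 0; set v1 := v _ 0; set w1 := w _ 0.
move: v0 v1 w0 w1 => [a b] [c d] [e f] [g l].
by case: k => [[|[|//]] ?] /=; apply/eqP; rewrite eq_complex /=;
  apply/andP; split; apply/eqP; ring.
Qed.

Lemma spin_act_gam (s : R[i]) (k : 'I_2) : s * s^* = 1 ->
  (\sum_(l < 2) (rotation (s ^+ 2) k l)%:C *: gam l) *m spin_act s
  = spin_act s *m gam k.
Proof.
case: s => a b /eqP; rewrite eq_complex /= => /andP[/eqP h _].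
have h1 : a * a + b * b = 1 by rewrite -h; ring.
have ha : a * a * a + b * b * a = a by rewrite -mulrDl h1 mul1r.
have hb : a * a * b + b * b * b = b by rewrite -mulrDl h1 mul1r.
rewrite /spin_act /= !big_ord_recl !big_ord0.
apply/matrixP => r s.
rewrite !(mxE, big_ord_recl, big_ord0) /=.
case: k r s => [[|[|//]] ?] [[|[|//]] ?] [[|[|//]] ?] /=;
  apply/eqP; rewrite eq_complex /= ?mulr1n;
  apply/andP; split; apply/eqP; try ring; lra.
Qed.

Lemma spin_act_unitary (s : R[i]) (v w : 'cV[R[i]]_2) : s * s^* = 1 ->
  hdot (spin_act s *m v) (spin_act s *m w) = hdot v w.
Proof.
case: s => a b /eqP; rewrite eq_complex /= => /andP[/eqP h _].
have h1 : a * a + b * b = 1 by rewrite -h; ring.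
have hx (x : R) : x = (a * a + b * b) * x by rewrite h1 mul1r.
rewrite /hdot /spin_act !(mxE, big_ord_recl, big_ord0) /=.
set v0 := v 0 0; set w0 := w 0 0; set v1 := v _ 0; set w1 := w _ 0.
move: v0 v1 w0 w1 => [p q] [c d] [e f] [g l].
apply/eqP; rewrite eq_complex /= ?mulr1n.
apply/andP; split; apply/eqP; rewrite [RHS]hx; ring.
Qed.
End Checks.

Section SpinSurface.
Variables (R : realType) (M : topologicalType).
Variables (S : smooth_structure R M) (h : riemannian_metric S).

(* A spin structure given by local sections p_a of the Spin(2)-bundle:
   the section p_a lives over the domain of the chart spch a and lies over the
   orthonormal frame whose two vectors are the rows of frame a, in the
   coordinates spch a; these frames are the oriented ones. On overlaps
   p_b = p_a * spin_lift a b with spin_lift a b in Spin(2) = U(1), hence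
   frame b is obtained from frame a by the rotation covered by
   spin_lift a b. *)
Record spin_structure := SpinStructure {
  spin_index : Type;
  spch : spin_index -> chart R M;
  frame : spin_index -> plane R -> 'M[R]_2;
  spin_lift : spin_index -> spin_index -> M -> R[i];
  spch_atlas : forall a, atlas S (spch a);
  spch_cover : forall x : M, exists a, dom (spch a) x;
  frame_smooth : forall a k l,
    smooth_on (chart_map (spch a) @` dom (spch a)) (fun p => frame a p k l);
  frame_orthonormal : forall a p, (chart_map (spch a) @` dom (spch a)) p ->
    frame a p *m gram h (spch a) p *m (frame a p)^T = 1%:M;
  spin_lift_smooth : forall a b,
    csmooth_on (chart_map (spch a) @` (dom (spch a) `&` dom (spch b)))
      (spin_lift a b \o param (spch a));
  spin_lift_unit : forall a b x, dom (spch a) x -> dom (spch b) x ->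
    spin_lift a b x * (spin_lift a b x)^* = 1;
  spin_lift_cocycle : forall a b c x,
    dom (spch a) x -> dom (spch b) x -> dom (spch c) x ->
    spin_lift a c x = spin_lift a b x * spin_lift b c x;
  spin_lift_frame : forall a b x, dom (spch a) x -> dom (spch b) x ->
    frame b (chart_map (spch b) x)
      *m 'J (trans (spch b) (spch a)) (chart_map (spch b) x)
    = rotation (spin_lift a b x ^+ 2) *m frame a (chart_map (spch a) x) }.

Variable P : spin_structure.

(* Local representatives of a (not necessarily continuous) spinor field:
   psi a x is the value at x in the trivialization of the spinor bundle
   P x_Spin(2) C^2 given by p_a, and is only meaningful on dom (spch a). *)
Definition local_reps := spin_index P -> M -> 'cV[R[i]]_2.

Definition compatible_reps (psi : local_reps) : Prop :=
  forall a b x, dom (spch a) x -> dom (spch b) x ->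
    psi a x = spin_act (spin_lift a b x) *m psi b x.

Definition spinor_field (psi : local_reps) : Prop :=
  (forall a k, csmooth_on (chart_map (spch a) @` dom (spch a))
                 (fun p => psi a (param (spch a) p) k 0)) /\
  compatible_reps psi.

(* Pointwise hermitian product of spinor fields, computed at each point in some
   chosen trivialization around it; by [hprodE] the choice is irrelevant. *)
Definition hprod (psi eta : local_reps) (x : M) : R[i] :=
  let a := projT1 (cid (spch_cover P x)) in hdot (psi a x) (eta a x).

Lemma hprodE (psi eta : local_reps) (a : spin_index P) (x : M) :
  compatible_reps psi -> compatible_reps eta -> dom (spch a) x ->
  hprod psi eta x = hdot (psi a x) (eta a x).
Proof.
move=> hpsi heta xa; rewrite /hprod.
case: (cid _) => b xb /=.
rewrite (hpsi a b) // (heta a b) // spin_act_unitary //.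
exact: spin_lift_unit.
Qed.

(* Clifford multiplication by the tangent vector field with constant components
   v in the chart c: at x it is the action of
   \sum_k h(v, e_k) e_k, where e_1, e_2 is the frame of the trivialization. *)
Definition clifford (c : chart R M) (v : 'rV[R]_2) (psi : local_reps)
    : local_reps := fun a x =>
  let p := chart_map (spch a) x in
  let w := v *m 'J (trans c (spch a)) (chart_map c x)
             *m gram h (spch a) p *m (frame a p)^T in
  \sum_(k < 2) (w 0 k)%:C *: (gam k *m psi a x).

(* Connection form h(nabla_v e_1, e_2) of the frame e_1, e_2. *)
Definition conn_form (a : spin_index P) (v : 'rV[R]_2) (p : plane R) : R :=
  (covder h (spch a) v (fun q => row 0 (frame a q)) p
     *m gram h (spch a) p *m (row 1 (frame a p))^T) 0 0.

(* nabla_v psi = v(psi) + (1/2) h(nabla_v e_1, e_2) e_1 . e_2 . psi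
   in the trivialization a, for v a tangent vector in the coordinates spch a *)
Definition spin_connection (v : 'rV[R]_2) (psi : local_reps)
    : local_reps := fun a x =>
  let p := chart_map (spch a) x in
  (\col_k \sum_(m < 2)
      (v 0 m)%:C * cpder m (fun q => psi a (param (spch a) q) k 0) p)
  + (2^-1 * conn_form a v p)%:C *: (gam 0 *m gam 1 *m psi a x).

Definition dirac_op (psi : local_reps) : local_reps := fun a x =>
  \sum_(k < 2) gam k *m
    spin_connection (row k (frame a (chart_map (spch a) x))) psi a x.

Definition volume_elt : 'M[R[i]]_2 := 'i *: (gam 0 *m gam 1).

Definition P_plus (psi : local_reps) : local_reps := fun a x =>
  2^-1 *: ((1%:M + volume_elt) *m psi a x).

Definition P_minus (psi : local_reps) : local_reps := fun a x =>
  2^-1 *: ((1%:M - volume_elt) *m psi a x).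

Definition coord_der (c : chart R M) (k : 'I_2) (f : M -> R[i]) (x : M) : R[i] :=
  cpder k (f \o param c) (chart_map c x).

Definition current (c : chart R M) (psi eta : local_reps) (k : 'I_2) (x : M)
    : R[i] :=
  hprod psi (clifford c (e_ k) eta) x.

End SpinSurface.

(* Main.v *)
(* The currents J_x, J_y are the components of the one-form
   A(X) = <psi^i, X . psi^m>, so the first two terms are dA(d_x, d_y).  For an
   orthonormal frame,
     dA(e_1, e_2) = e_1 A(e_2) - e_2 A(e_1) - A([e_1, e_2]);
   since the Levi-Civita connection is metric and torsion-free, the connection
   terms coming from the spinors cancel those of [e_1, e_2], and there remains
   <psi^i, e_1 . e_2 . D psi^m> - <e_1 . e_2 . D psi^i, psi^m>, that is
     dA(e_1, e_2) = 2 (lambda + kappa |psi|^2) <psi^i, e_1 . e_2 . psi^m>.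
   Passing to orthogonal d_x, d_y multiplies both e_1 . e_2 and two-forms by the
   same area factor.  Writing spinors as (P_+ psi, P_- psi), the symmetry
   hypothesis says exactly that the quadratic expression in the currents equals
   2 |psi|^2 <psi^i, d_x . d_y . psi^m>, which cancels the kappa term. *)

Require Import Defs.
From mathcomp Require Import all_boot all_order all_algebra.
From mathcomp Require Import complex ring lra.
From mathcomp Require Import all_classical all_reals all_analysis.

Set Implicit Arguments.
Unset Strict Implicit.
Unset Printing Implicit Defensive.
Import Order.TTheory GRing.Theory Num.Theory.
Import numFieldNormedType.Exports.

(** * Partial derivatives in the coordinate plane *)

Lemma big_ord2 (V : zmodType) (F : 'I_2 -> V) : \sum_(k < 2) F k = F 0 + F 1.
Proof. by rewrite big_ord_recl big_ord1; congr (_ + F _); apply: val_inj. Qed.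

Lemma ord2P (k : 'I_2) : k = 0 \/ k = 1.
Proof. by case: k => [[|[|//]] ?]; [left|right]; apply: val_inj. Qed.

Section Calculus.
Variable R : realType.
Implicit Types (f g : plane R -> R^o) (p v : plane R).

Lemma is_derive_line f p v (s : R) : differentiable f (p + s *: v) ->
  is_derive s 1 (fun t : R => f (p + t *: v)) ('D_v f (p + s *: v)).
Proof.
move=> /(@diff_derivable _ _ _ f _ v) df.
have E : (fun h : R => h^-1 *: (((fun t => f (p + t *: v)) \o shift s) (h *: 1)
            - f (p + s *: v))) =
  (fun h : R => h^-1 *: ((f \o shift (p + s *: v)) (h *: v) - f (p + s *: v))).
  apply/funext => h /=; congr (_ *: (f _ - _)).
  by rewrite [h *: 1]mulr1 scalerDl addrCA.
by split; [rewrite /derivable E | rewrite /derive E].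
Qed.

Lemma MVT0 (g dg : R -> R) (t : R) : 0 < t ->
  (forall s, 0 <= s <= t -> is_derive s 1 g (dg s)) ->
  exists2 s, 0 <= s <= t & g t - g 0 = dg s * t.
Proof.
move=> t0 dgs.
have [s s0t] : exists2 s, s \in `]0, t[%R & g t - g 0 = dg s * (t - 0).
  apply: MVT => // [s|].
    by rewrite in_itv /= => /andP[? ?]; apply: dgs; rewrite !ltW.
  apply: derivable_within_continuous => s; rewrite in_itv /= => hs.
  by have [] := dgs s hs.
rewrite subr0 => E; exists s => //.
by move: s0t; rewrite in_itv /= => /andP[? ?]; rewrite !ltW.
Qed.

(* Both orders of differentiation express the same second difference. *)
Lemma second_difference f p (i j : 'I_2) (t : R) : 0 < t ->
  (forall a b, 0 <= a <= t -> 0 <= b <= t ->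
    differentiable f (p + a *: e_ i + b *: e_ j) /\
    differentiable (pder i f) (p + a *: e_ i + b *: e_ j)) ->
  exists a b, [/\ 0 <= a <= t, 0 <= b <= t &
    f (p + t *: e_ i + t *: e_ j) - f (p + t *: e_ i) - f (p + t *: e_ j) + f p
    = t * t * pder j (pder i f) (p + a *: e_ i + b *: e_ j)].
Proof.
move=> t0 df.
have tt : 0 <= t <= t by rewrite lexx ltW.
have h0 : 0 <= (0 : R) <= t by rewrite lexx ltW.
have [a a0t Ea] : exists2 a, 0 <= a <= t &
    (f (p + t *: e_ j + t *: e_ i) - f (p + t *: e_ i))
    - (f (p + t *: e_ j + 0 *: e_ i) - f (p + 0 *: e_ i))
    = (pder i f (p + t *: e_ j + a *: e_ i) - pder i f (p + a *: e_ i)) * t.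
  apply: (@MVT0 (fun s => f (p + t *: e_ j + s *: e_ i) - f (p + s *: e_ i))
     (fun s => pder i f (p + t *: e_ j + s *: e_ i) - pder i f (p + s *: e_ i))
     t t0) => s hs.
  apply: is_deriveB; apply: is_derive_line.
    by rewrite addrAC; case: (df s t hs tt).
  by case: (df s 0 hs h0); rewrite scale0r addr0.
have [b b0t Eb] : exists2 b, 0 <= b <= t &
    pder i f (p + a *: e_ i + t *: e_ j) - pder i f (p + a *: e_ i + 0 *: e_ j)
    = pder j (pder i f) (p + a *: e_ i + b *: e_ j) * t.
  apply: (@MVT0 (fun s => pder i f (p + a *: e_ i + s *: e_ j))
     (fun s => pder j (pder i f) (p + a *: e_ i + s *: e_ j)) t t0) => s hs.
  by apply: is_derive_line; case: (df a s a0t hs).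
exists a, b; split => //.
rewrite !scale0r !addr0 in Ea Eb.
rewrite [p + t *: e_ j + a *: e_ i]addrAC Eb in Ea.
rewrite [p + t *: e_ j + t *: e_ i]addrAC in Ea.
lra.
Qed.

Lemma separate_values f g p (U : set (plane R)) : nbhs p U ->
  {for p, continuous f} -> {for p, continuous g} -> f p != g p ->
  exists2 r : R, 0 < r & forall q q', `|p - q| < r -> `|p - q'| < r ->
    U q /\ f q != g q'.
Proof.
move=> NU cf cg fg.
have d0 : 0 < `|f p - g p| / 2 by rewrite divr_gt0 // normr_gt0 subr_eq0.
have H1 := (cvgrPdist_lt _ _).1 cf _ d0.
have H2 := (cvgrPdist_lt _ _).1 cg _ d0.
have [r /= r0 Hr] := (nbhs_normP _ _).1
  (filterS3 _ (fun q a b c => And3 a b c) NU (H1 _) (H2 _)).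
exists r => // q q' /Hr [Uq Hq _] /Hr [_ _ Hq']; split => //.
apply/eqP => E; move: Hq Hq'; rewrite E => Hq Hq'.
have := ler_distD (g q') (f p) (g p).
rewrite [`|g q' - g p|]distrC => H.
by have := le_lt_trans H (ltrD Hq Hq'); rewrite -splitr ltxx.
Qed.

Lemma pder_comm (U : set (plane R)) f p (i j : 'I_2) :
  open U -> smooth_on U f -> U p ->
  pder i (pder j f) p = pder j (pder i f) p.
Proof.
move=> oU sf Up.
have cont (k l : 'I_2) : {for p, continuous (pder k (pder l f))}.
  by apply: differentiable_continuous; apply: (sf [:: k; l]).
apply/eqP/negPn/negP => ne.
have [r r0 Hr] :=
  separate_values (open_nbhs_nbhs (conj oU Up)) (cont i j) (cont j i) ne.
set C : R := `|e_ i : plane R| + `|e_ j : plane R| + 1.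
have C0 : 0 < C by rewrite ltr_wpDl // addr_ge0.
pose t := r / C.
have t0 : 0 < t by rewrite divr_gt0.
have box (k l : 'I_2) (a b : R) : `|e_ k : plane R| + `|e_ l : plane R| + 1 = C ->
    0 <= a <= t -> 0 <= b <= t -> `|p - (p + a *: e_ k + b *: e_ l)| < r.
  move=> EC /andP[a0 at_] /andP[b0 bt].
  rewrite -addrA opprD addrA subrr sub0r normrN.
  apply: (le_lt_trans (ler_normD _ _)).
  rewrite !normrZ !ger0_norm //.
  have -> : r = t * C by rewrite /t divfK // gt_eqF.
  rewrite -EC !mulrDr mulr1; apply: ltr_pwDr => //.
  by rewrite lerD // ler_wpM2r.
have [] := @second_difference f p i j t t0.
  move=> a b ha hb.
  have [Uq _] := Hr _ _ (@box i j a b erefl ha hb) (@box i j a b erefl ha hb).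
  by split; [exact: (sf [::])|exact: (sf [:: i])].
move=> a [b [ha hb E1]].
have EC : `|e_ j : plane R| + `|e_ i : plane R| + 1 = C by rewrite [X in X + 1]addrC.
have [] := @second_difference f p j i t t0.
  move=> a' b' ha' hb'.
  have [Uq _] := Hr _ _ (@box j i a' b' EC ha' hb') (@box j i a' b' EC ha' hb').
  by split; [exact: (sf [::])|exact: (sf [:: j])].
move=> a' [b' [ha' hb' E2]].
have [_ /eqP[]] := Hr _ _ (@box j i a' b' EC ha' hb') (@box i j a b erefl ha hb).
have tt0 : t * t != 0 by rewrite mulf_neq0 // gt_eqF.
apply: (@mulfI R _ tt0); apply: (etrans (esym E2)); apply: etrans E1.
rewrite [p + t *: e_ j + t *: e_ i]addrAC; congr (_ + _); exact: addrAC.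
Qed.

Lemma row2E p : p = p 0 0 *: e_ 0 + p 0 1 *: e_ 1.
Proof. by rewrite [LHS]row_sum_delta big_ord2. Qed.

Lemma differentiable_row (T : plane R -> plane R) p :
  (forall k, differentiable (fun q => T q 0 k : R^o) p) -> differentiable T p.
Proof.
move=> dT.
have -> : T = (fun q => T q 0 0 *: e_ 0) + (fun q => T q 0 1 *: e_ 1).
  by apply/funext => q; exact: row2E.
by apply: differentiableD; apply: differentiableZl.
Qed.

Lemma jacobian_pder (T : plane R -> plane R) p (k l : 'I_2) :
  (forall k, differentiable (fun q => T q 0 k : R^o) p) ->
  'J T p k l = pder k (fun q => T q 0 l) p.
Proof.
move=> dT; have dTp := differentiable_row dT.
rewrite /pder -[LHS](_ : (e_ k *m 'J T p) 0 l = _).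
  rewrite -deriveEjacobian // derive_mx ?mxE //.
  exact: diff_derivable.
by rewrite -rowE mxE.
Qed.

Lemma pder_comp f (T : plane R -> plane R) p (k : 'I_2) :
  (forall k, differentiable (fun q => T q 0 k : R^o) p) ->
  differentiable f (T p) ->
  pder k (f \o T) p = \sum_(l < 2) 'J T p k l * pder l f (T p).
Proof.
move=> dT df; have dTp := differentiable_row dT.
have E : 'd T p (e_ k) = 'J T p k 0 *: e_ 0 + 'J T p k 1 *: e_ 1 :> plane R.
  by rewrite -deriveE // deriveEjacobian // -rowE [LHS]row2E !mxE.
rewrite /pder deriveE; last exact: differentiable_comp.
rewrite diff_comp //= E linearD !linearZ /=.
by rewrite -!deriveE // big_ord2.
Qed.

Lemma near_pder f g p k : (\near p, f p = g p) -> pder k f p = pder k g p.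
Proof. exact: near_eq_derive. Qed.

End Calculus.

Section ComplexCalculus.
Variable R : realType.
Implicit Types (f g : plane R -> R[i]) (r : plane R -> R^o) (p : plane R).

Definition cdifferentiable f p :=
  differentiable (fun q => complex.Re (f q) : R^o) p /\
  differentiable (fun q => complex.Im (f q) : R^o) p.

Lemma pderD r1 r2 p k : differentiable r1 p -> differentiable r2 p ->
  pder k (fun q => r1 q + r2 q : R^o) p = pder k r1 p + pder k r2 p.
Proof. by move=> d1 d2; apply: (@deriveD _ _ _ r1 r2); apply: diff_derivable. Qed.

Lemma pderB r1 r2 p k : differentiable r1 p -> differentiable r2 p ->
  pder k (fun q => r1 q - r2 q : R^o) p = pder k r1 p - pder k r2 p.
Proof. by move=> d1 d2; apply: (@deriveB _ _ _ r1 r2); apply: diff_derivable. Qed.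

Lemma pderN r p k : differentiable r p ->
  pder k (fun q => - r q : R^o) p = - pder k r p.
Proof. by move=> d; apply: (@deriveN _ _ _ r); apply: diff_derivable. Qed.

Lemma pderM r1 r2 p k : differentiable r1 p -> differentiable r2 p ->
  pder k (fun q => r1 q * r2 q : R^o) p
  = pder k r1 p * r2 p + r1 p * pder k r2 p.
Proof.
move=> d1 d2; rewrite [LHS](@deriveM _ _ r1 r2); try exact: diff_derivable.
by rewrite addrC [X in X + _]mulrC.
Qed.

Lemma pder_cst (x : R) p k : pder k (fun=> x : R^o) p = 0.
Proof. exact: derive_cst. Qed.

Lemma cdifferentiableD f g p : cdifferentiable f p -> cdifferentiable g p ->
  cdifferentiable (fun q => f q + g q) p.
Proof.
move=> [f1 f2] [g1 g2]; split.
  rewrite [X in differentiable X _](_ : _ =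
  (fun q => complex.Re (f q) + complex.Re (g q) : R^o)).
    exact: differentiableD f1 g1.
  by apply/funext => q; case: (f q); case: (g q).
rewrite [X in differentiable X _](_ : _ =
  (fun q => complex.Im (f q) + complex.Im (g q) : R^o)).
  exact: differentiableD f2 g2.
by apply/funext => q; case: (f q); case: (g q).
Qed.

Lemma cdifferentiableM f g p : cdifferentiable f p -> cdifferentiable g p ->
  cdifferentiable (fun q => f q * g q) p.
Proof.
move=> [f1 f2] [g1 g2]; split.
  rewrite [X in differentiable X _](_ : _ =
  (fun q => complex.Re (f q) * complex.Re (g q)
    - complex.Im (f q) * complex.Im (g q) : R^o)).
    exact: differentiableB (differentiableM f1 g1) (differentiableM f2 g2).
  by apply/funext => q; case: (f q); case: (g q).
rewrite [X in differentiable X _](_ : _ =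
  (fun q => complex.Re (f q) * complex.Im (g q)
    + complex.Im (f q) * complex.Re (g q) : R^o)).
  exact: differentiableD (differentiableM f1 g2) (differentiableM f2 g1).
by apply/funext => q; case: (f q); case: (g q).
Qed.

Lemma cdifferentiable_conj f p : cdifferentiable f p ->
  cdifferentiable (fun q => (f q)^*%R) p.
Proof.
move=> [f1 f2]; split.
  rewrite [X in differentiable X _](_ : _ =
  (fun q => complex.Re (f q) : R^o)) //.
  by apply/funext => q; case: (f q).
rewrite [X in differentiable X _](_ : _ = (fun q => - complex.Im (f q) : R^o)).
  exact: differentiableN f2.
by apply/funext => q; case: (f q).
Qed.

Lemma cdifferentiable_real r p : differentiable r p ->
  cdifferentiable (fun q => (r q)%:C) p.
Proof. by split => //=; exact: differentiable_cst. Qed.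

Lemma cdifferentiable_cst (z : R[i]) p : cdifferentiable (fun=> z) p.
Proof. by split; exact: differentiable_cst. Qed.

Lemma cpderD f g p k : cdifferentiable f p -> cdifferentiable g p ->
  cpder k (fun q => f q + g q) p = cpder k f p + cpder k g p.
Proof.
move=> [f1 f2] [g1 g2]; rewrite /cpder.
rewrite [X in pder k X p +i* _](_ : _ =
  (fun q => complex.Re (f q) + complex.Re (g q) : R^o)); last first.
  by apply/funext => q; case: (f q); case: (g q).
rewrite [X in _ +i* pder k X p](_ : _ =
  (fun q => complex.Im (f q) + complex.Im (g q) : R^o)); last first.
  by apply/funext => q; case: (f q); case: (g q).
by rewrite !pderD.
Qed.

Lemma cpderM f g p k : cdifferentiable f p -> cdifferentiable g p ->
  cpder k (fun q => f q * g q) p = cpder k f p * g p + f p * cpder k g p.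
Proof.
move=> [f1 f2] [g1 g2]; rewrite /cpder.
rewrite [X in pder k X p +i* _](_ : _ =
  (fun q => complex.Re (f q) * complex.Re (g q)
    - complex.Im (f q) * complex.Im (g q) : R^o)); last first.
  by apply/funext => q; case: (f q); case: (g q).
rewrite [X in _ +i* pder k X p](_ : _ =
  (fun q => complex.Re (f q) * complex.Im (g q)
    + complex.Im (f q) * complex.Re (g q) : R^o)); last first.
  by apply/funext => q; case: (f q); case: (g q).
rewrite pderB ?pderD ?pderM //; try exact: differentiableM.
case: (f p) (g p) => [a b] [c d]; apply/eqP; rewrite eq_complex /=.
move: (pder _ _ _) (pder _ _ _) (pder _ _ _) (pder _ _ _) => s t u v.
by apply/andP; split; apply/eqP; ring.
Qed.

Lemma cpder_conj f p k : cdifferentiable f p ->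
  cpder k (fun q => (f q)^*%R) p = (cpder k f p)^*%R.
Proof.
move=> [f1 f2]; rewrite /cpder.
rewrite [X in pder k X p +i* _](_ : _ =
  (fun q => complex.Re (f q) : R^o)); last first.
  by apply/funext => q; case: (f q).
rewrite [X in _ +i* pder k X p](_ : _ = (fun q => - complex.Im (f q) : R^o)); last first.
  by apply/funext => q; case: (f q).
by rewrite pderN.
Qed.

Lemma cpder_real r p k : cpder k (fun q => (r q)%:C) p = (pder k r p)%:C.
Proof. by rewrite /cpder /= pder_cst. Qed.

Lemma cpder_cst (z : R[i]) p k : cpder k (fun=> z) p = 0.
Proof. by rewrite /cpder !pder_cst. Qed.

Lemma cpder_comp f (T : plane R -> plane R) p (k : 'I_2) :
  (forall k, differentiable (fun q => T q 0 k : R^o) p) ->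
  cdifferentiable f (T p) ->
  cpder k (f \o T) p = \sum_(l < 2) ('J T p k l)%:C * cpder l f (T p).
Proof.
move=> dT [f1 f2]; rewrite /cpder.
rewrite [X in X +i* _](pder_comp _ dT f1) [X in _ +i* X](pder_comp _ dT f2).
rewrite !big_ord2.
move: ('J T p k 0) ('J T p k 1) (pder _ _ _) (pder _ _ _) (pder _ _ _)
  (pder _ _ _) => j0 j1 a b c d.
apply/eqP; rewrite eq_complex /=.
by rewrite !mul0r !subr0 !addr0 !eqxx.
Qed.

Lemma cdifferentiable_comp f (T : plane R -> plane R) p :
  (forall k, differentiable (fun q => T q 0 k : R^o) p) ->
  cdifferentiable f (T p) -> cdifferentiable (f \o T) p.
Proof.
move=> /differentiable_row dT [f1 f2].
by split; [exact: (differentiable_comp dT f1)|exact: (differentiable_comp dT f2)].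
Qed.

Lemma near_cpder f g p k : (\near p, f p = g p) -> cpder k f p = cpder k g p.
Proof.
move=> fg; rewrite /cpder; congr (_ +i* _); apply: near_pder.
  by apply: filterS fg => q ->.
by apply: filterS fg => q ->.
Qed.

(* d commutes with pullback: the second derivatives of [T] cancel by symmetry. *)
Lemma curl_pullback (U : set (plane R)) (T : plane R -> plane R)
    (A J : 'I_2 -> plane R -> R[i]) p :
  open U -> U p -> (forall k, smooth_on U (fun q => T q 0 k)) ->
  (forall l, cdifferentiable (A l) (T p)) ->
  (forall k, \near p, J k p = \sum_(l < 2) ('J T p k l)%:C * A l (T p)) ->
  cpder 0 (J 1) p - cpder 1 (J 0) p
  = ('J T p 0 0 * 'J T p 1 1 - 'J T p 0 1 * 'J T p 1 0)%:C
    * (cpder 0 (A 1) (T p) - cpder 1 (A 0) (T p)).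
Proof.
move=> oU Up sT dA HJ.
have dT q : U q -> forall k, differentiable (fun q => T q 0 k : R^o) q.
  by move=> Uq k; exact: (sT k [::]).
have E (k m : 'I_2) : cpder k (J m) p = \sum_(l < 2)
    ((pder k (pder m (fun q => T q 0 l)) p)%:C * A l (T p)
     + ('J T p m l)%:C * \sum_(n < 2) ('J T p k n)%:C * cpder n (A l) (T p)).
  rewrite (@near_cpder _ (fun q =>
    (pder m (fun q => T q 0 0) q)%:C * A 0 (T q)
    + (pder m (fun q => T q 0 1) q)%:C * A 1 (T q))); last first.
    apply: filterS2 (HJ m) (open_nbhs_nbhs (conj oU Up)) => q -> Uq.
    by rewrite big_ord2 !(jacobian_pder _ _ (dT q Uq)).
  have dd (l : 'I_2) : cdifferentiable (fun q => (pder m (fun q => T q 0 l) q)%:C) p.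
    by apply: cdifferentiable_real; apply: (sT l [:: m]).
  have dAT l : cdifferentiable (fun q => A l (T q)) p.
    by apply: cdifferentiable_comp => //; apply: dT.
  rewrite cpderD; try exact: cdifferentiableM.
  rewrite !cpderM // !cpder_real.
  rewrite -!(jacobian_pder _ _ (dT p Up)).
  by rewrite !(cpder_comp _ (dT p Up)) // !big_ord2.
rewrite !E !big_ord2.
rewrite !(pder_comm 0 1 oU (sT _) Up).
rewrite !(rmorphB, rmorphM) /=.
move: (cpder _ _ _) (cpder _ _ _) (cpder _ _ _) (cpder _ _ _) => a b c d.
move: (A 0 (T p)) (A 1 (T p)) => x y.
move: (pder _ _ _) (pder _ _ _) ('J T p 0 0) ('J T p 0 1) ('J T p 1 0)
  ('J T p 1 1) => s t j00 j01 j10 j11.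
move: s%:C t%:C j00%:C j01%:C j10%:C j11%:C => {}s {}t {}j00 {}j01 {}j10 {}j11.
ring.
Qed.

End ComplexCalculus.

(** * Changes of charts and trivializations *)

Section Charts.
Variables (R : realType) (M : topologicalType).
Implicit Types (c d : chart R M).

Lemma near_param c (V : set M) (x : M) : dom c x -> open V -> V x ->
  \forall p \near chart_map c x,
    [/\ dom c (param c p), chart_map c (param c p) = p & V (param c p)].
Proof.
move=> cx oV Vx.
have Ux : (chart_map c @` dom c) (chart_map c x) by exists x.
have N1 : \forall p \near chart_map c x, (chart_map c @` dom c) p.
  by apply: open_nbhs_nbhs; split => //; exact: img_open.
have N2 : \forall p \near chart_map c x, V (param c p).
  apply: (param_cont Ux); rewrite param_coord //.
  exact: open_nbhs_nbhs.
apply: filterS2 N1 N2 => p [y cy <-].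
by rewrite param_coord.
Qed.

Lemma overlap_open c d : open (chart_map c @` (dom c `&` dom d)).
Proof.
rewrite openE => p [x [cx dx] <-].
rewrite /interior; apply: filterS (near_param cx (@dom_open _ _ d) dx) => q [cq E dq].
by exists (param c q).
Qed.

Variable S : smooth_structure R M.

Lemma trans_differentiable c d x k : atlas S c -> atlas S d ->
  dom c x -> dom d x ->
  differentiable (fun p => trans c d p 0 k : R^o) (chart_map c x).
Proof.
move=> Sc Sd cx dx; apply: (atlas_smooth Sc Sd k [::]).
by exists x.
Qed.

Lemma transE c d x : dom c x -> trans c d (chart_map c x) = chart_map d x.
Proof. by move=> cx; rewrite /trans /= param_coord. Qed.

Lemma trans_jacobianM c d e x : atlas S c -> atlas S d -> atlas S e ->
  dom c x -> dom d x -> dom e x ->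
  'J (trans c e) (chart_map c x) =
  'J (trans c d) (chart_map c x) *m 'J (trans d e) (chart_map d x).
Proof.
move=> Sc Sd Se cx dx ex; apply/matrixP => k l.
have dce m := @trans_differentiable c e x m Sc Se cx ex.
have dcd m := @trans_differentiable c d x m Sc Sd cx dx.
have dde m := @trans_differentiable d e x m Sd Se dx ex.
rewrite -(transE d cx) in dde.
rewrite [RHS]mxE; apply: (etrans (@jacobian_pder _ _ _ k l dce)).
have E : \forall p \near chart_map c x,
    trans c e p 0 l = ((fun p => trans d e p 0 l) \o trans c d) p.
  apply: filterS (near_param cx (@dom_open _ _ d) dx) => q [cq Eq dq].
  by rewrite -Eq /= !transE.
apply: (etrans (near_pder k E)).
apply: (etrans (@pder_comp _ (fun p => trans d e p 0 l) _ _ k dcd (dde l))).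
apply: eq_bigr => m _; congr (_ * _).
by rewrite -(@jacobian_pder _ _ _ m l dde) (transE d cx).
Qed.

End Charts.

Section SpinAction.
Variable R : realType.

Lemma rotation_orthogonal (z : R[i]) : z * z^*%R = 1 ->
  rotation z *m (rotation z)^T = 1%:M.
Proof.
case: z => a b /eqP; rewrite eq_complex /= => /andP[/eqP h _].
have h1 : a * a + b * b = 1 by rewrite -h; ring.
apply/matrixP => k l; rewrite !mxE big_ord2 !mxE /=.
by case: k l => [[|[|//]] ?] [[|[|//]] ?] /=; rewrite -?h1; ring.
Qed.

Lemma rotation_sqr_orthogonal (s : R[i]) : s * s^*%R = 1 ->
  (rotation (s ^+ 2))^T *m rotation (s ^+ 2) = 1%:M.
Proof.
move=> s1; apply: mulmx1C; apply: rotation_orthogonal.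
by rewrite rmorphXn -exprMn s1 expr1n.
Qed.

Definition clif (w : 'rV[R]_2) : 'M[R[i]]_2 := \sum_(k < 2) (w 0 k)%:C *: gam k.

Lemma clif_spin_act (s : R[i]) (w : 'rV[R]_2) : s * s^*%R = 1 ->
  clif (w *m rotation (s ^+ 2)) *m spin_act s = spin_act s *m clif w.
Proof.
move=> s1; rewrite /clif mulmx_sumr.
under [RHS]eq_bigr do rewrite -scalemxAr -spin_act_gam // scalemxAl.
rewrite -mulmx_suml; congr (_ *m _).
under [RHS]eq_bigr do rewrite scaler_sumr.
rewrite exchange_big /=; apply: eq_bigr => l _.
rewrite mxE rmorph_sum scaler_suml; apply: eq_bigr => k _.
by rewrite rmorphM scalerA.
Qed.

Lemma hdotZr (v w : 'cV[R[i]]_2) (r : R) : hdot v (r%:C *: w) = r%:C * hdot v w.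
Proof.
rewrite /hdot mulr_sumr; apply: eq_bigr => k _; rewrite mxE rmorphM mulrCA.
by congr (_ * _); exact: conjc_real.
Qed.

Lemma hdotDr (v w1 w2 : 'cV[R[i]]_2) : hdot v (w1 + w2) = hdot v w1 + hdot v w2.
Proof.
by rewrite /hdot -big_split; apply: eq_bigr => k _; rewrite mxE rmorphD mulrDr.
Qed.

End SpinAction.

Section LocalFormulas.
Variables (R : realType) (M : topologicalType).
Variables (S : smooth_structure R M) (h : riemannian_metric S).
Variable P : spin_structure h.
Variables (c : chart R M) (catlas : atlas S c).

Definition coframe (a : spin_index P) (p : plane R) : 'M[R]_2 :=
  gram h (spch a) p *m (frame a p)^T.

Lemma frame_coframe a x : dom (spch a) x ->
  frame a (chart_map (spch a) x) *m coframe a (chart_map (spch a) x) = 1%:M.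
Proof. by move=> ax; rewrite mulmxA; apply: frame_orthonormal; exists x. Qed.

Lemma cliffordE (v : 'rV[R]_2) (psi : local_reps P) a x :
  clifford c v psi a x =
  clif (v *m 'J (trans c (spch a)) (chart_map c x)
          *m coframe a (chart_map (spch a) x)) *m psi a x.
Proof.
rewrite /clif mulmx_suml; apply: eq_bigr => k _.
by rewrite -scalemxAl /coframe !mulmxA.
Qed.

Lemma clifford_compatible (v : 'rV[R]_2) (psi : local_reps P) a b x :
  compatible_reps psi -> dom c x -> dom (spch a) x -> dom (spch b) x ->
  clifford c v psi a x = spin_act (spin_lift a b x) *m clifford c v psi b x.
Proof.
move=> hpsi cx ax bx; rewrite !cliffordE (hpsi a b x ax bx).
have s1 := spin_lift_unit ax bx.
rewrite mulmxA [RHS]mulmxA -(clif_spin_act _ s1).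
congr (clif _ *m _ *m _).
have Sa := spch_atlas a; have Sb := spch_atlas b.
rewrite (trans_jacobianM catlas Sb Sa cx bx ax) -!mulmxA; congr (_ *m (_ *m _)).
have Ub : (chart_map (spch b) @` (dom (spch b) `&` dom (spch a))) (chart_map (spch b) x).
  by exists x.
have Ua : (chart_map (spch a) @` dom (spch a)) (chart_map (spch a) x) by exists x.
have Eg := gram_trans h Sb Sa Ub; rewrite transE // in Eg.
rewrite /coframe Eg -!mulmxA.
set J := 'J _ _ in Eg *.
have -> : J^T *m ((frame b (chart_map (spch b) x))^T *m rotation (spin_lift a b x ^+ 2))
   = (frame b (chart_map (spch b) x) *m J)^T *m rotation (spin_lift a b x ^+ 2).
  by rewrite trmx_mul mulmxA.
rewrite (spin_lift_frame ax bx) trmx_mul -mulmxA rotation_sqr_orthogonal //.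
by rewrite mulmx1.
Qed.

(* The one-form X |-> <psi, X . eta>, in the coordinates of [spch a]. *)
Definition current_form (psi eta : local_reps P) a (l : 'I_2) (p : plane R)
    : R[i] :=
  \sum_(m < 2) (coframe a p l m)%:C
    * hdot (psi a (param (spch a) p)) (gam m *m eta a (param (spch a) p)).

Lemma currentE (psi eta : local_reps P) a k x :
  compatible_reps psi -> compatible_reps eta -> dom c x -> dom (spch a) x ->
  current c psi eta k x = \sum_(l < 2) ('J (trans c (spch a)) (chart_map c x) k l)%:C
    * current_form psi eta a l (chart_map (spch a) x).
Proof.
move=> hpsi heta cx ax; rewrite /current /hprod.
case: (cid _) => b bx /=.
rewrite (hpsi b a x bx ax) (@clifford_compatible (e_ k) eta b a x heta cx bx ax).
rewrite spin_act_unitary; last exact: spin_lift_unit.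
rewrite cliffordE /clif !big_ord2 mulmxDl -!scalemxAl hdotDr !hdotZr.
rewrite /current_form param_coord // !big_ord2.
have E m : (e_ k *m 'J (trans c (spch a)) (chart_map c x)
       *m coframe a (chart_map (spch a) x)) 0 m
    = 'J (trans c (spch a)) (chart_map c x) k 0 * coframe a (chart_map (spch a) x) 0 m
    + 'J (trans c (spch a)) (chart_map c x) k 1 * coframe a (chart_map (spch a) x) 1 m.
  by move: ('J _ _) => J; rewrite [LHS]mxE big_ord2 -rowE !mxE.
rewrite !E !rmorphD !rmorphM /=.
move: (hdot _ _) (hdot _ _) => u v.
ring.
Qed.

End LocalFormulas.

(** * Levi-Civita connection and Dirac operator in a frame *)

Section Algebra.
Variable R : realType.

(* Torsion-freeness: [e_1, e_2] = nabla_{e_1} e_2 - nabla_{e_2} e_1, where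
   nabla_v e_1 = w(v) e_2 and nabla_v e_2 = - w(v) e_1. *)
Lemma frame_bracket (F C : 'M[R]_2) (dF dg : 'I_2 -> 'I_2 -> 'I_2 -> R)
    (w : 'I_2 -> R) :
  F *m C = 1%:M ->
  (forall m n u, dg m n u = dg m u n) ->
  (forall m k l, \sum_(s < 2) dF m k s * C s l
     + \sum_(n < 2) \sum_(u < 2) F k n * dg m n u * F l u
     + \sum_(s < 2) dF m l s * C s k = 0) ->
  (forall k, w k = \sum_(m < 2) F k m * (\sum_(s < 2) dF m 0 s * C s 1
     + 2^-1 * \sum_(n < 2) \sum_(u < 2)
         F 0 n * F 1 u * (dg m n u + dg n m u - dg u m n))) ->
  forall n, \sum_(m < 2) (F 0 m * dF m 1 n - F 1 m * dF m 0 n)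
            = - w 0 * F 0 n - w 1 * F 1 n.
Proof.
move=> FC dgC compat wE.
pose D (a k l : 'I_2) := \sum_(m < 2) F a m * \sum_(s < 2) dF m k s * C s l.
pose Q (a k l : 'I_2) := \sum_(m < 2) F a m *
  \sum_(n < 2) \sum_(u < 2) F k n * dg m n u * F l u.
have DQ a k l : D a k l + Q a k l + D a l k = 0.
  rewrite /D /Q -!big_split big1 //= => m _.
  by rewrite -!mulrDr compat mulr0.
have QC a k l : Q a k l = Q a l k.
  rewrite /Q; apply: eq_bigr => m _; congr (_ * _).
  by rewrite !big_ord2 (dgC m 1 0); ring.
have wDQ a : w a = D a 0 1 + 2^-1 * (Q a 0 1 + Q 0 a 1 - Q 1 a 0).
  rewrite wE /D /Q !big_ord2 (dgC 0 1 0) (dgC 1 1 0); ring.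
pose X : 'rV[R]_2 := \row_n (\sum_(m < 2) (F 0 m * dF m 1 n - F 1 m * dF m 0 n)
            - (- w 0 * F 0 n - w 1 * F 1 n)).
have FCE k l : F k 0 * C 0 l + F k 1 * C 1 l = (k == l)%:R.
  by have /matrixP/(_ k l) := FC; rewrite !mxE big_ord2.
have XC : X *m C = 0.
  apply/rowP => k; rewrite !mxE big_ord2 !mxE.
  transitivity (D 0 1 k - D 1 0 k + w 0 * (F 0 0 * C 0 k + F 0 1 * C 1 k)
                 + w 1 * (F 1 0 * C 0 k + F 1 1 * C 1 k)).
    by rewrite /D !big_ord2; ring.
  rewrite !FCE !wDQ.
  have := DQ 0 0 1; have := DQ 1 0 0; have := DQ 0 1 1.
  have := QC 1 1 0; have := QC 0 1 0; have := DQ 0 1 0.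
  clearbody D Q.
  by case: (ord2P k) => ->; rewrite /= mulr1 mulr0; lra.
have X0 : X = 0 by rewrite -[X]mulmx1 -(mulmx1C FC) mulmxA XC mul0mx.
move=> n; apply/eqP; rewrite -subr_eq0; apply/eqP.
by have /rowP/(_ n) := X0; rewrite !mxE.
Qed.

Lemma mul_ii : 'i * 'i = -1 :> R[i].
Proof. by rewrite -expr2 sqr_i. Qed.

Lemma conj_ii : ('i : R[i])^*%R = - 'i.
Proof. by apply/eqP; rewrite eq_complex /= oppr0 !eqxx. Qed.

Lemma colD (v w : 'cV[R[i]]_2) k : (v + w) k 0 = v k 0 + w k 0.
Proof. by rewrite mxE. Qed.

Lemma colN (v : 'cV[R[i]]_2) k : (- v) k 0 = - v k 0.
Proof. by rewrite mxE. Qed.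

Lemma colZ (z : R[i]) (v : 'cV[R[i]]_2) k : (z *: v) k 0 = z * v k 0.
Proof. by rewrite mxE. Qed.

Lemma hdotE (v w : 'cV[R[i]]_2) : hdot v w = v 0 0 * (w 0 0)^*%R + v 1 0 * (w 1 0)^*%R.
Proof. by rewrite /hdot big_ord2. Qed.

Lemma gam0E (v : 'cV[R[i]]_2) :
  ((gam 0 *m v) 0 0 = 'i * v 1 0) * ((gam 0 *m v) 1 0 = 'i * v 0 0).
Proof. by rewrite !mxE !big_ord2 !mxE /= !mul0r addr0 add0r. Qed.

Lemma gam1E (v : 'cV[R[i]]_2) :
  ((gam 1 *m v) 0 0 = v 1 0) * ((gam 1 *m v) 1 0 = - v 0 0).
Proof. by rewrite !mxE !big_ord2 !mxE /= !mul0r addr0 add0r mul1r mulN1r. Qed.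

Lemma dirac_current (F : 'M[R]_2) (w : 'I_2 -> R) (psi eta : 'cV[R[i]]_2)
    (dpsi deta : 'I_2 -> 'cV[R[i]]_2) (mu : R[i]) : mu^*%R = mu ->
  \sum_(k < 2) gam k *m (\sum_(m < 2) (F k m)%:C *: dpsi m
     + (2^-1 * w k)%:C *: (gam 0 *m gam 1 *m psi)) = mu *: psi ->
  \sum_(k < 2) gam k *m (\sum_(m < 2) (F k m)%:C *: deta m
     + (2^-1 * w k)%:C *: (gam 0 *m gam 1 *m eta)) = mu *: eta ->
  \sum_(m < 2)
      ((F 0 m)%:C * (hdot (dpsi m) (gam 1 *m eta) + hdot psi (gam 1 *m deta m))
       - (F 1 m)%:C * (hdot (dpsi m) (gam 0 *m eta) + hdot psi (gam 0 *m deta m)))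
    + (w 0)%:C * hdot psi (gam 0 *m eta) + (w 1)%:C * hdot psi (gam 1 *m eta)
  = 2 * mu * hdot psi (gam 0 *m (gam 1 *m eta)).
Proof.
move=> mu_real Dpsi Deta.
pose Dp (k : 'I_2) := \sum_(m < 2) (F k m)%:C *: dpsi m.
pose De (k : 'I_2) := \sum_(m < 2) (F k m)%:C *: deta m.
transitivity (hdot (Dp 0) (gam 1 *m eta) + hdot psi (gam 1 *m De 0)
  - hdot (Dp 1) (gam 0 *m eta) - hdot psi (gam 0 *m De 1)
    + (w 0)%:C * hdot psi (gam 0 *m eta) + (w 1)%:C * hdot psi (gam 1 *m eta)).
  congr (_ + _ + _).
  have hl (r s : R) (u1 u2 v : 'cV[R[i]]_2) :
      hdot (r%:C *: u1 + s%:C *: u2) v = r%:C * hdot u1 v + s%:C * hdot u2 v.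
    by rewrite !hdotE !mxE; ring.
  have hr (r s : R) (G : 'M[R[i]]_2) (u1 u2 v : 'cV[R[i]]_2) :
      hdot v (G *m (r%:C *: u1 + s%:C *: u2))
      = r%:C * hdot v (G *m u1) + s%:C * hdot v (G *m u2).
    by rewrite mulmxDr -!scalemxAr hdotDr !hdotZr.
  have DpE k : Dp k = (F k 0)%:C *: dpsi 0 + (F k 1)%:C *: dpsi 1 by exact: big_ord2.
  have DeE k : De k = (F k 0)%:C *: deta 0 + (F k 1)%:C *: deta 1 by exact: big_ord2.
  rewrite big_ord2 (DpE 0) (DpE 1) (DeE 0) (DeE 1).
  rewrite (hl (F 0 0)) (hl (F 1 0)) (hr (F 0 0)) (hr (F 1 0)).
  move: (F 0 0)%:C (F 0 1)%:C (F 1 0)%:C (F 1 1)%:C => f00 f01 f10 f11.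
  move: (hdot (dpsi 0) _) (hdot (dpsi 1) _) (hdot (dpsi 0) _) (hdot (dpsi 1) _)
    (hdot psi _) (hdot psi _) (hdot psi _) (hdot psi _) => a b c d e f g h.
  ring.
pose hw (k : 'I_2) : R[i] := (2^-1 * w k)%:C.
have Ep (phi : 'cV[R[i]]_2) (D : 'I_2 -> 'cV[R[i]]_2) :
    \sum_(k < 2) gam k *m (D k + hw k *: (gam 0 *m gam 1 *m phi)) = mu *: phi ->
  D 1 1 0 = mu * phi 0 0 - 'i * D 0 1 0 + hw 0 * phi 1 0 - hw 1 * 'i * phi 1 0 /\
  D 1 0 0 = 'i * D 0 0 0 + hw 0 * phi 0 0 + hw 1 * 'i * phi 0 0 - mu * phi 1 0.
  pose X k := D k + hw k *: (gam 0 *m gam 1 *m phi).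
  have X0 k : X k 0 0 = D k 0 0 - hw k * 'i * phi 0 0.
    by rewrite /X -mulmxA mxE mxE !(gam0E, gam1E); ring.
  have X1 k : X k 1 0 = D k 1 0 + hw k * 'i * phi 1 0.
    by rewrite /X -mulmxA mxE mxE !(gam0E, gam1E); ring.
  rewrite big_ord2 -/(X 0) -/(X 1) => E.
  have : 'i * X 0 1 0 + X 1 1 0 = mu * phi 0 0.
    move/matrixP/(_ 0 0): E; rewrite mxE [X in _ = X]mxE.
    by rewrite (gam0E (X 0)).1 (gam1E (X 1)).1.
  have : 'i * X 0 0 0 - X 1 0 0 = mu * phi 1 0.
    move/matrixP/(_ 1 0): E; rewrite mxE [X in _ = X]mxE.
    by rewrite (gam0E (X 0)).2 (gam1E (X 1)).2.
  rewrite !X0 !X1.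
  move: (D 0 0 0) (D 0 1 0) (D 1 0 0) (D 1 1 0) (phi 0 0) (phi 1 0)
    (hw 0) (hw 1) => a b c d u v h0 h1 E1 E0.
  by split; [rewrite -E0|rewrite -E1]; ring: mul_ii.
have [p1 p0] := Ep psi Dp Dpsi; have [e1 e0] := Ep eta De Deta.
have w2 k : (w k)%:C = 2 * hw k.
  by rewrite /hw -(rmorph_nat (real_complex R)) -rmorphM mulrA divff ?mul1r // pnatr_eq0.
have conj_hw k : (hw k)^*%R = hw k by exact: conjc_real.
rewrite !hdotE !(gam0E, gam1E) p1 p0 e1 e0 !w2.
rewrite !(rmorphD, rmorphB, rmorphN, rmorphM) /= !conj_hw mu_real conj_ii.
move: (Dp 0 0 0) (Dp 0 1 0) (psi 0 0) (psi 1 0) => a b u v.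
move: (_^*%R) (_^*%R) (_^*%R) (_^*%R) => a' b' u' v'.
ring: mul_ii.
Qed.
End Algebra.

Section SpinorDerivatives.
Variable R : realType.
Implicit Types (f g : plane R -> 'cV[R[i]]_2) (p : plane R).

Definition vdifferentiable f p := forall k, cdifferentiable (fun q => f q k 0) p.

Definition vpder (m : 'I_2) f p : 'cV[R[i]]_2 := \col_k cpder m (fun q => f q k 0) p.

Lemma vdifferentiable_mul (G : 'M[R[i]]_2) f p :
  vdifferentiable f p -> vdifferentiable (fun q => G *m f q) p.
Proof.
move=> df k.
have -> : (fun q => (G *m f q) k 0) = (fun q => G k 0 * f q 0 0 + G k 1 * f q 1 0).
  by apply/funext => q; rewrite mxE big_ord2.
by apply: cdifferentiableD; apply: cdifferentiableM => //; apply: cdifferentiable_cst.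
Qed.

Lemma vpder_mul (G : 'M[R[i]]_2) f p m : vdifferentiable f p ->
  vpder m (fun q => G *m f q) p = G *m vpder m f p.
Proof.
move=> df; apply/colP => k; rewrite mxE [RHS]mxE big_ord2 !mxE.
have -> : (fun q => (G *m f q) k 0) = (fun q => G k 0 * f q 0 0 + G k 1 * f q 1 0).
  by apply/funext => q; rewrite mxE big_ord2.
have dG (l : 'I_2) : cdifferentiable (fun=> G k l) p by exact: cdifferentiable_cst.
rewrite cpderD; try exact: cdifferentiableM.
by rewrite !cpderM // !cpder_cst !mul0r !add0r.
Qed.

Lemma hdot_fun f g : (fun q => hdot (f q) (g q))
  = (fun q => f q 0 0 * (g q 0 0)^*%R + f q 1 0 * (g q 1 0)^*%R).
Proof. by apply/funext => q; rewrite hdotE. Qed.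

Lemma cdifferentiable_hdot f g p : vdifferentiable f p -> vdifferentiable g p ->
  cdifferentiable (fun q => hdot (f q) (g q)) p.
Proof.
move=> df dg; rewrite hdot_fun.
by apply: cdifferentiableD; apply: cdifferentiableM => //; apply: cdifferentiable_conj.
Qed.

Lemma cpder_hdot f g p m : vdifferentiable f p -> vdifferentiable g p ->
  cpder m (fun q => hdot (f q) (g q)) p
  = hdot (vpder m f p) (g p) + hdot (f p) (vpder m g p).
Proof.
move=> df dg; rewrite hdot_fun.
have dc k := cdifferentiable_conj (dg k).
rewrite cpderD; try exact: cdifferentiableM.
rewrite !cpderM // !cpder_conj // !hdotE !mxE.
by rewrite addrACA.
Qed.

End SpinorDerivatives.

Section FrameCalculus.
Variables (R : realType) (M : topologicalType).
Variables (S : smooth_structure R M) (h : riemannian_metric S).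
Variable P : spin_structure h.
Variables (a : spin_index P) (x : M) (ax : dom (spch a) x).
Let p := chart_map (spch a) x.
Let U := chart_map (spch a) @` dom (spch a).
Let F := frame a p.
Let C := coframe a p.
Let g := gram h (spch a).

Let Up : U p. Proof. by exists x. Qed.

Let near_U : \forall q \near p, U q.
Proof. by apply: open_nbhs_nbhs; split => //; exact: img_open. Qed.

Let FC q : U q -> frame a q *m coframe a q = 1%:M.
Proof. by case=> y ay <-; apply: frame_coframe. Qed.

Let dF k l : differentiable (fun q => frame a q k l : R^o) p.
Proof. exact: (@frame_smooth _ _ _ _ P a k l [::] p Up). Qed.

Let dg k l : differentiable (fun q => g q k l : R^o) p.
Proof. exact: (@gram_smooth _ _ _ h _ (spch_atlas a) k l [::] p Up). Qed.

Let g_sym q k l : U q -> g q k l = g q l k.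
Proof.
by move=> Uq; have /matrixP/(_ l k) := gram_sym h (spch_atlas a) Uq; rewrite mxE.
Qed.

Let Dg m n u := pder m (fun q => g q n u) p.
Let DF m k n := pder m (fun q => frame a q k n) p.

Lemma pder_gram_sym m n u : Dg m n u = Dg m u n.
Proof. by apply: near_pder; apply: filterS near_U => q; apply: g_sym. Qed.

Lemma metric_compatible m k l :
  \sum_(s < 2) DF m k s * C s l
  + \sum_(n < 2) \sum_(u < 2) F k n * Dg m n u * F l u
  + \sum_(s < 2) DF m l s * C s k = 0.
Proof.
have E : pder m (fun q => frame a q k 0 * (g q 0 0 * frame a q l 0 + g q 0 1 * frame a q l 1)
     + frame a q k 1 * (g q 1 0 * frame a q l 0 + g q 1 1 * frame a q l 1) : R^o) p = 0.
  rewrite -(pder_cst ((k == l)%:R : R) p m); apply: near_pder.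
  apply: filterS near_U => q Uq; have /matrixP/(_ k l) := FC Uq.
  by rewrite !mxE big_ord2 !mxE !big_ord2 !mxE.
have dgF i j (n : 'I_2) : differentiable (fun q => g q i j * frame a q n j : R^o) p.
  exact: differentiableM.
have dgFF i (n : 'I_2) : differentiable
    (fun q => g q i 0 * frame a q n 0 + g q i 1 * frame a q n 1 : R^o) p.
  exact: (differentiableD (dgF i 0 n) (dgF i 1 n)).
rewrite pderD in E; try exact: (differentiableM (dF _ _) (dgFF _ _)).
rewrite !(pderM _ (dF _ _) (dgFF _ _)) !(pderD _ (dgF _ _ _) (dgF _ _ _)) in E.
rewrite !(pderM _ (dg _ _) (dF _ _)) in E.
rewrite -!/(Dg _ _ _) -!/(DF _ _ _) -/F in E.
have CE s n : C s n = g p s 0 * F n 0 + g p s 1 * F n 1.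
  by rewrite /C /coframe mxE big_ord2 !mxE.
rewrite !big_ord2 !CE -E (g_sym 1 0 Up).
move: (DF) (Dg) (F) (g p) => DF' Dg' F' g'.
ring.
Qed.

Lemma conn_formE k :
  conn_form a (row k F) p =
  \sum_(m < 2) F k m * (\sum_(s < 2) DF m 0 s * C s 1
     + 2^-1 * \sum_(n < 2) \sum_(u < 2)
         F 0 n * F 1 u * (Dg m n u + Dg n m u - Dg u m n)).
Proof.
have FgI : F *m g p *m invmx (g p) = F.
  apply: mulmxK; have : F *m g p *m F^T = 1%:M by exact: frame_orthonormal.
  rewrite -mulmxA => /mulmx1C; rewrite -mulmxA => /mulmx1_unit[].
  done.
have CI t : \sum_(s < 2) C s 1 * invmx (g p) s t = F 1 t.
  rewrite -[in RHS]FgI [RHS]mxE; apply: eq_bigr => s _; congr (_ * _).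
  rewrite /C /coframe !mxE; apply: eq_bigr => u _.
  by rewrite !mxE g_sym // mulrC.
have rowE m s : pder m (fun q => (row 0 (frame a q)) 0 s) p = DF m 0 s.
  by congr (pder _ _ _); apply/funext => q; rewrite mxE.
rewrite /conn_form -mulmxA mxE.
have E s : (gram h (spch a) p *m (row 1 (frame a p))^T) s 0 = C s 1.
  by rewrite /C /coframe !mxE; apply: eq_bigr => u _; rewrite !mxE.
transitivity (\sum_(s < 2) \sum_(m < 2) F k m * (DF m 0 s
     + \sum_(n < 2) christoffel h (spch a) p s m n * F 0 n) * C s 1).
  apply: eq_bigr => s _; rewrite E mxE mulr_suml; apply: eq_bigr => m _.
  rewrite rowE !mxE; congr (_ * (_ + _) * _).
  by apply: eq_bigr => n _; rewrite !mxE.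
rewrite exchange_big; apply: eq_bigr => m _.
under eq_bigr do rewrite -mulrA.
rewrite -mulr_sumr; congr (_ * _).
under eq_bigr do rewrite mulrDl.
rewrite big_split; congr (_ + _).
rewrite /christoffel -!/(Dg _ _ _).
have I0 := CI 0; have I1 := CI 1; rewrite !big_ord2 in I0 I1.
rewrite !big_ord2 -I0 -I1.
rewrite -/g -!/(Dg _ _ _).
move: (Dg) (F) (C) (invmx (g p)) => Dg' F' C' G'.
ring.
Qed.

End FrameCalculus.

Lemma form_curl_frame (R : realType) (F : 'M[R]_2) (w : 'I_2 -> R)
    (dF : 'I_2 -> 'I_2 -> 'I_2 -> R) (A : 'I_2 -> R[i]) (dA dK : 'I_2 -> 'I_2 -> R[i]) :
  (forall n, \sum_(m < 2) (F 0 m * dF m 1 n - F 1 m * dF m 0 n)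
             = - w 0 * F 0 n - w 1 * F 1 n) ->
  (forall k m, dK k m
     = \sum_(l < 2) ((dF m k l)%:C * A l + (F k l)%:C * dA m l)) ->
  (F 0 0 * F 1 1 - F 0 1 * F 1 0)%:C * (dA 0 1 - dA 1 0)
  = \sum_(m < 2) ((F 0 m)%:C * dK 1 m - (F 1 m)%:C * dK 0 m)
    + (w 0)%:C * ((F 0 0)%:C * A 0 + (F 0 1)%:C * A 1)
    + (w 1)%:C * ((F 1 0)%:C * A 0 + (F 1 1)%:C * A 1).
Proof.
move=> B DK.
have BA n : (\sum_(m < 2) (F 0 m * dF m 1 n - F 1 m * dF m 0 n))%:C * A n
    = (- w 0 * F 0 n - w 1 * F 1 n)%:C * A n by rewrite B.
have := BA 0; have := BA 1.
rewrite !big_ord2 !DK !big_ord2 !(rmorphD, rmorphB, rmorphN, rmorphM) /=.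
move: (dA 0 0) (dA 0 1) (dA 1 0) (dA 1 1) (A 0) (A 1) => a1 a2 a3 a4 u v.
move: (F 0 0)%:C (F 0 1)%:C (F 1 0)%:C (F 1 1)%:C (w 0)%:C (w 1)%:C
  => f00 f01 f10 f11 w0 w1.
move: (dF 0 0 0)%:C (dF 0 0 1)%:C (dF 0 1 0)%:C (dF 0 1 1)%:C
  (dF 1 0 0)%:C (dF 1 0 1)%:C (dF 1 1 0)%:C (dF 1 1 1)%:C.
move=> d000 d001 d010 d011 d100 d101 d110 d111 B1 B0.
set L := LHS; set Q := RHS.
have -> : Q = L + ((f00 * d010 - f10 * d000 + (f01 * d110 - f11 * d100)) * u
     - (- w0 * f00 - w1 * f10) * u)
   + ((f00 * d011 - f10 * d001 + (f01 * d111 - f11 * d101)) * v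
     - (- w0 * f01 - w1 * f11) * v) by rewrite /L /Q; ring.
by rewrite B0 B1 !subrr !addr0.
Qed.

Section CurrentCurl.
Variables (R : realType) (M : topologicalType).
Variables (S : smooth_structure R M) (h : riemannian_metric S).
Variable P : spin_structure h.
Variables (a : spin_index P) (x : M) (ax : dom (spch a) x).
Let p := chart_map (spch a) x.
Let F := frame a p.

Let loc (phi : local_reps P) q := phi a (param (spch a) q).

Let loc_p (phi : local_reps P) : loc phi p = phi a x.
Proof. by rewrite /loc /p param_coord. Qed.

Let Up : (chart_map (spch a) @` dom (spch a)) p.
Proof. by exists x. Qed.

Let near_U : \forall q \near p, (chart_map (spch a) @` dom (spch a)) q.
Proof. by apply: open_nbhs_nbhs; split => //; exact: img_open. Qed.

Let dF k l : differentiable (fun q => frame a q k l : R^o) p.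
Proof. exact: (@frame_smooth _ _ _ _ P a k l [::] p Up). Qed.

Lemma loc_differentiable (phi : local_reps P) :
  spinor_field phi -> vdifferentiable (loc phi) p.
Proof.
move=> [sphi _] k; have [s1 s2] := sphi a k.
by split; [exact: (s1 [::] p Up)|exact: (s2 [::] p Up)].
Qed.

Lemma coframe_differentiable l m :
  differentiable (fun q => coframe a q l m : R^o) p.
Proof.
have dg i j : differentiable (fun q => gram h (spch a) q i j : R^o) p.
  exact: (@gram_smooth _ _ _ h _ (spch_atlas a) i j [::] p Up).
rewrite [X in differentiable X _](_ : _ = (fun q =>
  gram h (spch a) q l 0 * frame a q m 0 + gram h (spch a) q l 1 * frame a q m 1 : R^o)).
  exact: (differentiableD (differentiableM (dg l 0) (dF m 0))
                         (differentiableM (dg l 1) (dF m 1))).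
by apply/funext => q; rewrite /coframe mxE big_ord2 !mxE.
Qed.

Variables (psi eta : local_reps P).
Hypotheses (spsi : spinor_field psi) (seta : spinor_field eta).

Let K m q := hdot (loc psi q) (gam m *m loc eta q).

Let dK m : cdifferentiable (K m) p.
Proof.
apply: cdifferentiable_hdot; first exact: loc_differentiable.
by apply: vdifferentiable_mul; exact: loc_differentiable.
Qed.

Let A := current_form psi eta a.

Lemma current_form_differentiable l : cdifferentiable (A l) p.
Proof.
have -> : A l = (fun q => (coframe a q l 0)%:C * K 0 q + (coframe a q l 1)%:C * K 1 q).
  by apply/funext => q; exact: big_ord2.
have dC m := cdifferentiable_real (coframe_differentiable l m).
by apply: cdifferentiableD; apply: cdifferentiableM.
Qed.

Let frame_form k q : (chart_map (spch a) @` dom (spch a)) q ->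
  K k q = (frame a q k 0)%:C * A 0 q + (frame a q k 1)%:C * A 1 q.
Proof.
case=> y ay <-; have FC := frame_coframe ay.
have E m : frame a (chart_map (spch a) y) k 0 * coframe a (chart_map (spch a) y) 0 m
  + frame a (chart_map (spch a) y) k 1 * coframe a (chart_map (spch a) y) 1 m = (k == m)%:R.
  have /matrixP/(_ k m) := FC; rewrite mxE [X in _ = X -> _]mxE big_ord2.
  exact.
rewrite /A /current_form !big_ord2 -!/(K _ _).
move: E; move: (K) (frame a _) (coframe a _) => K' F' C' E.
transitivity ((k == 0)%:R%:C * K' 0 (chart_map (spch a) y)
              + (k == 1)%:R%:C * K' 1 (chart_map (spch a) y)).
  case: (ord2P k) => ->; rewrite /=.
    by rewrite mul1r mul0r addr0.
  by rewrite mul1r mul0r add0r.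
rewrite -!E !rmorphD !rmorphM /=.
move: (K' 0 _) (K' 1 _) => u v; ring.
Qed.

Lemma current_form_curl (mu : R[i]) : mu^*%R = mu ->
  dirac_op psi a x = mu *: psi a x -> dirac_op eta a x = mu *: eta a x ->
  (F 0 0 * F 1 1 - F 0 1 * F 1 0)%:C * (cpder 0 (A 1) p - cpder 1 (A 0) p)
  = 2 * mu * hdot (psi a x) (gam 0 *m (gam 1 *m eta a x)).
Proof.
move=> mu_real Dpsi Deta.
pose w k := conn_form a (row k F) p.
have DE (phi : local_reps P) : dirac_op phi a x =
  \sum_(k < 2) gam k *m (\sum_(m < 2) (F k m)%:C *: vpder m (loc phi) p
     + (2^-1 * w k)%:C *: (gam 0 *m gam 1 *m phi a x)).
  apply: eq_bigr => k _; congr (_ *m (_ + _)).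
  apply/colP => i; rewrite mxE summxE; apply: eq_bigr => m _.
  by rewrite !mxE.
rewrite DE in Dpsi; rewrite DE in Deta.
rewrite -(dirac_current mu_real Dpsi Deta).
have EK k m : hdot (vpder m (loc psi) p) (gam k *m eta a x)
    + hdot (psi a x) (gam k *m vpder m (loc eta) p) = cpder m (K k) p.
  have dp := loc_differentiable spsi; have de := loc_differentiable seta.
  rewrite [RHS](cpder_hdot _ dp (vdifferentiable_mul (gam k) de)).
  by rewrite (vpder_mul _ _ de) !loc_p.
have KE k : hdot (psi a x) (gam k *m eta a x)
    = (F k 0)%:C * A 0 p + (F k 1)%:C * A 1 p.
  by rewrite -(frame_form k Up) /K !loc_p.
have dA := current_form_differentiable.
have cF k l := cdifferentiable_real (dF k l).
have DK k m : cpder m (K k) p = \sum_(l < 2)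
    ((pder m (fun q => frame a q k l) p)%:C * A l p + (F k l)%:C * cpder m (A l) p).
  rewrite (@near_cpder _ _ (fun q => (frame a q k 0)%:C * A 0 q
    + (frame a q k 1)%:C * A 1 q)); last first.
    by apply: filterS near_U => q; exact: frame_form.
  rewrite (cpderD _ (cdifferentiableM (cF k 0) (dA 0)) (cdifferentiableM (cF k 1) (dA 1))).
  rewrite (cpderM _ (cF k 0) (dA 0)) (cpderM _ (cF k 1) (dA 1)).
  by rewrite !cpder_real big_ord2.
have B n : \sum_(m < 2) (F 0 m * pder m (fun q => frame a q 1 n) p
       - F 1 m * pder m (fun q => frame a q 0 n) p) = - w 0 * F 0 n - w 1 * F 1 n.
  apply: (frame_bracket (frame_coframe ax)
           (dg := fun m n u => pder m (fun q => gram h (spch a) q n u) p)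
           (dF := fun m k n => pder m (fun q => frame a q k n) p)).
  - by move=> *; exact: pder_gram_sym.
  - by move=> *; exact: metric_compatible.
  - by move=> k; exact: conn_formE.
transitivity (\sum_(m < 2) ((F 0 m)%:C * cpder m (K 1) p - (F 1 m)%:C * cpder m (K 0) p)
    + (w 0)%:C * ((F 0 0)%:C * A 0 p + (F 0 1)%:C * A 1 p)
    + (w 1)%:C * ((F 1 0)%:C * A 0 p + (F 1 1)%:C * A 1 p)); last first.
  congr (_ + _ * _ + _ * _); [|exact: esym (KE 0)|exact: esym (KE 1)].
  by apply: eq_bigr => m _; congr (_ * _ - _ * _); exact: esym (EK _ _).
exact: (@form_curl_frame _ F w (fun m k n => pder m (fun q => frame a q k n) p)
  (fun l => A l p) (fun m l => cpder m (A l) p) (fun k m => cpder m (K k) p)).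
Qed.

End CurrentCurl.

(** * The quadratic term and isothermal coordinates *)

Section CurrentAlgebra.
Variable R : realType.
Implicit Types (v w : 'rV[R]_2) (psi eta : 'cV[R[i]]_2).

Definition wedge v w : R := v 0 0 * w 0 1 - v 0 1 * w 0 0.

Lemma imaginaryE : 'i%R = 'i :> R[i].
Proof. by []. Qed.

Lemma clif_orthogonal v w psi : v 0 0 * w 0 0 + v 0 1 * w 0 1 = 0 ->
  clif v *m (clif w *m psi) = (wedge v w)%:C *: (gam 0 *m (gam 1 *m psi)).
Proof.
move=> vw; have cE u (phi : 'cV[R[i]]_2) : clif u *m phi
    = (u 0 0)%:C *: (gam 0 *m phi) + (u 0 1)%:C *: (gam 1 *m phi).
  by rewrite /clif big_ord2 mulmxDl -!scalemxAl.
have vwC : (v 0 0)%:C * (w 0 0)%:C + (v 0 1)%:C * (w 0 1)%:C = 0 :> R[i].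
  by rewrite -!rmorphM -rmorphD vw.
have c0 u (phi : 'cV[R[i]]_2) : (clif u *m phi) 0 0
    = ((u 0 0)%:C * 'i + (u 0 1)%:C) * phi 1 0.
  by rewrite cE colD !colZ (gam0E phi).1 (gam1E phi).1; ring.
have c1 u (phi : 'cV[R[i]]_2) : (clif u *m phi) 1 0
    = ((u 0 0)%:C * 'i - (u 0 1)%:C) * phi 0 0.
  by rewrite cE colD !colZ (gam0E phi).2 (gam1E phi).2; ring.
apply/colP => k; case: (ord2P k) => ->.
  rewrite c0 c1 colZ (gam0E _).1 (gam1E _).2 /wedge rmorphB !rmorphM /=.
  move: vwC; move: (v 0 0)%:C (v 0 1)%:C (w 0 0)%:C (w 0 1)%:C (psi 0 0).
  move=> v0 v1 w0 w1 z E.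
  transitivity (- (v0 * w0 + v1 * w1) * z + (v0 * w1 - v1 * w0) * ('i * - z)).
    ring: (mul_ii R).
  by rewrite E oppr0 mul0r add0r.
rewrite c1 c0 colZ (gam0E _).2 (gam1E _).1 /wedge rmorphB !rmorphM /=.
move: vwC; move: (v 0 0)%:C (v 0 1)%:C (w 0 0)%:C (w 0 1)%:C (psi 1 0).
move=> v0 v1 w0 w1 z E.
transitivity (- (v0 * w0 + v1 * w1) * z + (v0 * w1 - v1 * w0) * ('i * z)).
  ring: (mul_ii R).
by rewrite E oppr0 mul0r add0r.
Qed.

Lemma hdot_conj psi : (hdot psi psi)^*%R = hdot psi psi.
Proof.
rewrite /hdot rmorph_sum; apply: eq_bigr => k _.
by rewrite rmorphM /= conjCK mulrC.
Qed.

Lemma chirality_projectors psi :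
  [/\ (2^-1 *: ((1%:M + volume_elt R) *m psi)) 0 0 = psi 0 0,
      (2^-1 *: ((1%:M + volume_elt R) *m psi)) 1 0 = 0,
      (2^-1 *: ((1%:M - volume_elt R) *m psi)) 0 0 = 0 &
      (2^-1 *: ((1%:M - volume_elt R) *m psi)) 1 0 = psi 1 0].
Proof.
have V0 : (volume_elt R *m psi) 0 0 = psi 0 0.
  rewrite /volume_elt imaginaryE -scalemxAl -mulmxA mxE (gam0E _).1 (gam1E _).2.
  by rewrite mulrA mul_ii mulN1r opprK.
have V1 : (volume_elt R *m psi) 1 0 = - psi 1 0.
  rewrite /volume_elt imaginaryE -scalemxAl -mulmxA mxE (gam0E _).2 (gam1E _).1.
  by rewrite mulrA mul_ii mulN1r.
have half (z : R[i]) : 2^-1 * (z + z) = z.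
  by rewrite -[in X in _ * X](mulr1 z) -mulrDr mulrCA mulVf ?mulr1 // pnatr_eq0.
rewrite mulmxDl mulmxBl mul1mx !colZ !colD !colN V0 V1 opprK !subrr !mulr0.
by rewrite !half.
Qed.

(* The quadratic part: with [u = P_+ psi] and [v = P_- psi], the left-hand side
   minus the right-hand side is a multiple of
   [|v^j|^2 <v^i, v^m> - |u^j|^2 <u^i, u^m>]. *)
Lemma current_quadratic (q : nat) (V : 'I_q -> 'cV[R[i]]_2) (i m : 'I_q) :
  let Pp phi := 2^-1 *: ((1%:M + volume_elt R) *m phi) in
  let Pm phi := 2^-1 *: ((1%:M - volume_elt R) *m phi) in
  \sum_(j < q) hdot (Pm (V j)) (Pm (V j)) * hdot (Pm (V i)) (Pm (V m))
  = \sum_(j < q) hdot (Pp (V j)) (Pp (V j)) * hdot (Pp (V i)) (Pp (V m)) ->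
  \sum_(j < q)
    (hdot (V i) (gam 0 *m V j) * hdot (V j) (gam 1 *m V m)
     - hdot (V i) (gam 1 *m V j) * hdot (V j) (gam 0 *m V m))
  = 2 * (\sum_(j < q) hdot (V j) (V j)) * hdot (V i) (gam 0 *m (gam 1 *m V m)).
Proof.
move=> Pp Pm Hsym.
have HpE phi chi : hdot (Pp phi) (Pp chi) = phi 0 0 * (chi 0 0)^*%R.
  have [E1 E2 _ _] := chirality_projectors phi.
  have [F1 F2 _ _] := chirality_projectors chi.
  by rewrite hdotE /Pp E1 E2 F1 F2 mul0r addr0.
have HmE phi chi : hdot (Pm phi) (Pm chi) = phi 1 0 * (chi 1 0)^*%R.
  have [_ _ E1 E2] := chirality_projectors phi.
  have [_ _ F1 F2] := chirality_projectors chi.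
  by rewrite hdotE /Pm E1 E2 F1 F2 mul0r add0r.
pose c : R[i] := 2 * 'i.
transitivity (c * \sum_(j < q)
   (V i 0 0 * (V m 0 0)^*%R * (V j 1 0 * (V j 1 0)^*%R)
    - V i 1 0 * (V m 1 0)^*%R * (V j 0 0 * (V j 0 0)^*%R))).
  rewrite mulr_sumr; apply: eq_bigr => j _.
  rewrite !hdotE !(gam0E (V _)).1 !(gam0E (V _)).2 !(gam1E (V _)).1 !(gam1E (V _)).2.
  rewrite !(rmorphM, rmorphN) /= !conj_ii /c.
  move: (V i 0 0) (V i 1 0) (V j 0 0) (V j 1 0) (V j 0 0)^*%R (V j 1 0)^*%R
    (V m 0 0)^*%R (V m 1 0)^*%R => a b c' d e f g h.
  ring.
have g01 : hdot (V i) (gam 0 *m (gam 1 *m V m))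
    = 'i * (V i 0 0 * (V m 0 0)^*%R - V i 1 0 * (V m 1 0)^*%R).
  rewrite hdotE (gam0E (gam 1 *m V m)).1 (gam0E (gam 1 *m V m)).2.
  rewrite (gam1E (V m)).1 (gam1E (V m)).2 !(rmorphM, rmorphN) /= !conj_ii; ring.
have NE : \sum_(j < q) hdot (V j) (V j) = \sum_(j < q) V j 0 0 * (V j 0 0)^*%R
   + \sum_(j < q) V j 1 0 * (V j 1 0)^*%R.
  by rewrite -big_split; apply: eq_bigr => j _; rewrite hdotE.
rewrite NE g01 sumrB -!mulr_sumr.
move: Hsym.
rewrite (eq_bigr _ (fun j _ => congr2 *%R (HmE (V j) (V j)) (HmE (V i) (V m)))).
rewrite [in X in _ = X](eq_bigr _
  (fun j _ => congr2 *%R (HpE (V j) (V j)) (HpE (V i) (V m)))).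
rewrite -!mulr_suml /c.
move: (\sum_(j < q) V j 0 0 * _) (\sum_(j < q) V j 1 0 * _) => U W.
move: (V i 0 0 * _) (V i 1 0 * _) => X Y E.
transitivity (2 * 'i * (X * W - Y * U) + 2 * 'i * (U * X - W * Y)); last ring.
by rewrite E subrr mulr0 addr0.
Qed.

End CurrentAlgebra.

Section IsothermalChart.
Variables (R : realType) (M : topologicalType).
Variables (S : smooth_structure R M) (h : riemannian_metric S).
Variable P : spin_structure h.
Variables (c : chart R M) (catlas : atlas S c).
Variables (a : spin_index P) (x : M) (cx : dom c x) (ax : dom (spch a) x).
Let J := 'J (trans c (spch a)) (chart_map c x).
Let F := frame a (chart_map (spch a) x).
Let C := coframe a (chart_map (spch a) x).

(* Row [k] of [J *m C] consists of the components of the coordinate vector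
   [d_k] in the frame. *)
Lemma current_frameE (psi eta : local_reps P) k :
  compatible_reps psi -> compatible_reps eta ->
  current c psi eta k x
  = ((J *m C) k 0)%:C * hdot (psi a x) (gam 0 *m eta a x)
    + ((J *m C) k 1)%:C * hdot (psi a x) (gam 1 *m eta a x).
Proof.
move=> hpsi heta; rewrite (currentE catlas _ hpsi heta cx ax).
rewrite /current_form param_coord // -/J -/C.
have E m : (J *m C) k m = J k 0 * C 0 m + J k 1 * C 1 m by rewrite mxE big_ord2.
rewrite !E !big_ord2 !rmorphD !rmorphM /=.
move: (hdot _ _) (hdot _ _) => u v; move: (J) (C) => J' C'; ring.
Qed.

Lemma coframe_gram : C *m C^T = gram h (spch a) (chart_map (spch a) x).
Proof.
have CF : C *m F = 1%:M by apply: mulmx1C; exact: frame_coframe.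
have Ux : (chart_map (spch a) @` dom (spch a)) (chart_map (spch a) x) by exists x.
have -> : C^T = F *m gram h (spch a) (chart_map (spch a) x).
  by rewrite /C /coframe trmx_mul trmxK (gram_sym h (spch_atlas a) Ux).
by rewrite mulmxA CF mul1mx.
Qed.

Lemma isothermal_orthogonal : isothermal h c ->
  (J *m C) 0 0 * (J *m C) 1 0 + (J *m C) 0 1 * (J *m C) 1 1 = 0.
Proof.
move=> ciso.
transitivity ((J *m C *m (J *m C)^T) 0 1).
  by move: (J *m C) => W; rewrite mxE big_ord2 !mxE.
have -> : J *m C *m (J *m C)^T = J *m (C *m C^T) *m J^T.
  by rewrite trmx_mul !mulmxA.
rewrite coframe_gram.
have Ux : (chart_map c @` (dom c `&` dom (spch a))) (chart_map c x) by exists x.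
have := gram_trans h catlas (spch_atlas a) Ux.
rewrite (transE _ cx) -/J => <-.
have [|r _ ->] := ciso (chart_map c x); first by exists x.
by rewrite mxE.
Qed.

Lemma wedge_frame : wedge (row 0 (J *m C)) (row 1 (J *m C))
    * (F 0 0 * F 1 1 - F 0 1 * F 1 0) = J 0 0 * J 1 1 - J 0 1 * J 1 0.
Proof.
have CF : C *m F = 1%:M by apply: mulmx1C; exact: frame_coframe.
have -> : wedge (row 0 (J *m C)) (row 1 (J *m C))
   = (J *m C) 0 0 * (J *m C) 1 1 - (J *m C) 0 1 * (J *m C) 1 0.
  by rewrite /wedge ![row _ _ _ _]mxE.
have JE k l : J k l = (J *m C) k 0 * F 0 l + (J *m C) k 1 * F 1 l.
  by rewrite -{1}[J]mulmx1 -CF mulmxA [LHS]mxE big_ord2.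
rewrite !JE; move: (J *m C) (F) => W F'; ring.
Qed.

Lemma current_curl (psi eta : local_reps P) (mu : R[i]) :
  spinor_field psi -> spinor_field eta -> mu^*%R = mu ->
  dirac_op psi a x = mu *: psi a x -> dirac_op eta a x = mu *: eta a x ->
  coord_der c 0 (current c psi eta 1) x - coord_der c 1 (current c psi eta 0) x
  = (wedge (row 0 (J *m C)) (row 1 (J *m C)))%:C
    * (2 * mu * hdot (psi a x) (gam 0 *m (gam 1 *m eta a x))).
Proof.
move=> spsi seta mu_real Dpsi Deta.
rewrite -(current_form_curl ax spsi seta mu_real Dpsi Deta) mulrA -rmorphM.
rewrite wedge_frame /coord_der.
have Sa := spch_atlas a.
rewrite (@curl_pullback _ (chart_map c @` (dom c `&` dom (spch a)))
  (trans c (spch a)) (current_form psi eta a)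
  (fun k => current c psi eta k \o param c)).
- by rewrite (transE _ cx).
- exact: overlap_open.
- by exists x.
- exact: atlas_smooth catlas Sa.
- by move=> l; rewrite (transE _ cx); exact: current_form_differentiable.
- move=> k; apply: filterS (near_param cx (@dom_open _ _ (spch a)) ax) => q [cq Eq aq].
  rewrite -{2 3}Eq (transE _ cq) /=.
  exact: (currentE catlas k spsi.2 seta.2 cq aq).
Qed.

End IsothermalChart.

Theorem lemma3p20 (R : realType) (M : topologicalType)
    (* a closed Riemannian spin surface *)
    (Mcompact : compact [set: M]) (Mhausdorff : hausdorff_space M)
    (S : smooth_structure R M) (h : riemannian_metric S) (P : spin_structure h)
    (* isothermal coordinates x = coordinate 0, y = coordinate 1 on dom c *)
    (c : chart R M) (catlas : atlas S c) (ciso : isothermal h c)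
    (lambda kappa : R) (q : nat) (psi : 'I_q -> local_reps P)
    (psi_smooth : forall i : 'I_q, spinor_field (psi i))
    (psi_dirac : forall (i : 'I_q) (a : spin_index P) (x : M), dom (spch a) x ->
       dirac_op (psi i) a x =
         lambda%:C *: psi i a x
         + (kappa%:C * \sum_(j < q) hprod (psi j) (psi j) x) *: psi i a x)
    (psi_sym : forall (i m : 'I_q) (x : M),
       \sum_(j < q) hprod (P_minus (psi j)) (P_minus (psi j)) x
                    * hprod (P_minus (psi i)) (P_minus (psi m)) x
       = \sum_(j < q) hprod (P_plus (psi j)) (P_plus (psi j)) x
                      * hprod (P_plus (psi i)) (P_plus (psi m)) x) :
  forall (i m : 'I_q) (x : M), dom c x ->
    coord_der c 0 (current c (psi i) (psi m) 1) x
    - coord_der c 1 (current c (psi i) (psi m) 0) x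
    - kappa%:C * \sum_(j < q)
        (current c (psi i) (psi j) 0 x * current c (psi j) (psi m) 1 x
         - current c (psi i) (psi j) 1 x * current c (psi j) (psi m) 0 x)
    = (lambda *+ 2)%:C
      * hprod (psi i) (clifford c (e_ 0) (clifford c (e_ 1) (psi m))) x.
Proof.
move=> i m x cx.
pose a := projT1 (cid (spch_cover P x)).
have ax : dom (spch a) x := projT2 (cid (spch_cover P x)).
have Dpsi j := psi_dirac j a x ax.
have := psi_sym i m x; rewrite /hprod -/a => Hsym.
pose N := \sum_(j < q) hdot (psi j a x) (psi j a x).
pose mu := lambda%:C + kappa%:C * N.
have mu_real : mu^*%R = mu.
  rewrite /mu rmorphD rmorphM /=; congr (_ + _ * _); try exact: conjc_real.
  by rewrite rmorph_sum; apply: eq_bigr => j _; exact: hdot_conj.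
have Dmu j : dirac_op (psi j) a x = mu *: psi j a x.
  by rewrite (Dpsi j) scalerDl.
rewrite (current_curl catlas cx ax (psi_smooth i) (psi_smooth m) mu_real (Dmu i) (Dmu m)).
set J := 'J _ _; set C := coframe _ _; set W := J *m C.
have curE j l k : current c (psi j) (psi l) k x
    = (W k 0)%:C * hdot (psi j a x) (gam 0 *m psi l a x)
    + (W k 1)%:C * hdot (psi j a x) (gam 1 *m psi l a x).
  exact: (current_frameE catlas cx ax k (psi_smooth j).2 (psi_smooth l).2).
have wE : wedge (row 0 W) (row 1 W) = W 0 0 * W 1 1 - W 0 1 * W 1 0.
  by rewrite /wedge ![row _ _ _ _]mxE.
have -> : \sum_(j < q)
        (current c (psi i) (psi j) 0 x * current c (psi j) (psi m) 1 x
         - current c (psi i) (psi j) 1 x * current c (psi j) (psi m) 0 x)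
   = (wedge (row 0 W) (row 1 W))%:C
     * (2 * N * hdot (psi i a x) (gam 0 *m (gam 1 *m psi m a x))).
  rewrite -(current_quadratic (V := fun j => psi j a x) Hsym) mulr_sumr.
  apply: eq_bigr => j _; rewrite !curE wE rmorphB !rmorphM /=.
  move: (hdot _ _) (hdot _ _) (hdot _ _) (hdot _ _) => s t u v.
  move: (W 0 0)%:C (W 0 1)%:C (W 1 0)%:C (W 1 1)%:C => w00 w01 w10 w11; ring.
have -> : clifford c (e_ 0) (clifford c (e_ 1) (psi m)) a x
   = (wedge (row 0 W) (row 1 W))%:C *: (gam 0 *m (gam 1 *m psi m a x)).
  rewrite !cliffordE -/J -/C -![_ *m _ *m C]mulmxA -!rowE; apply: clif_orthogonal.
  rewrite ![row _ _ _ _]mxE.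
  exact: (isothermal_orthogonal catlas cx ax ciso).
rewrite hdotZr /mu rmorphMn -mulr_natl /=.
move: (hdot _ _) (wedge _ _)%:C => Z w; ring.
Qed.
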